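(* Let $\epsilon_{\mathrm{eff}}$ and $\mu_{\mathrm{eff}}$ be the effective permittivity and permeability of the homogenized equation, as defined in the context, at a point where $\widetilde V=1$. Suppose that, for a given $0<s<1$, the permittivity $\epsilon_c$ of the plasmonic particles (depending on $N$) is $$\epsilon_c=\epsilon_{c,n}^*+s^{-1}\,\frac{\Lambda N^{-3a}\,c_n\,\epsilon_m}{(1/2-\lambda_n)^3\big(1-\beta_m^2k_m^2(1/2-\lambda_n)\big)^2}\,\tilde\gamma_m^{-1}.$$ Then $\epsilon_{\mathrm{eff}}$ and $\mu_{\mathrm{eff}}$ are both negative provided $s$ is sufficiently close to one; that is, there is $s_0\in(0,1)$ such that $\epsilon_{\mathrm{eff}}<0$ and $\mu_{\mathrm{eff}}<0$ for all $s\in(s_0,1)$.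
   Context: **Setting.** $N^3$ identical plasmonic particles $\delta B+z_j^N$ with permittivity $\epsilon_c$ and permeability $\mu_m$ (no chirality) are embedded in a bounded smooth domain of a chiral background with constants $\epsilon_m,\mu_m,\beta_m>0$, at fixed frequency $\omega>0$, where $k_m=\omega\sqrt{\epsilon_m\mu_m}$ satisfies $k_m\beta_m<1$. The particle size is $\delta=\Lambda^{1/3}N^{-1-a}$ with $\Lambda>0$, $a>0$. Here $B\subset\mathbb{R}^3$ is a bounded open set with smooth boundary and outward normal $\nu$. Put $\tilde\gamma_m=\frac1{1-k_m^2\beta_m^2}$ and $\gamma_m^2=\frac{k_m^2}{1-k_m^2\beta_m^2}$. The smooth function $\widetilde V$ is the asymptotic density of the particle centers, i.e. $N^{-3}\sum_j(\cdot)(z_j^N)$ is approximated by $\int(\cdot)\widetilde V$; for simplicity it is assumed that $\widetilde V=1$ at the point considered. **Spectral data.** $\mathcal{S}_B[\psi](x)=-\frac1{4\pi}\int_{\partial B}\frac{\psi(y)}{|x-y|}d\sigma(y)$, $\mathcal{K}_B^*[\psi](x)=\int_{\partial B}\frac{(x-y)\cdot\nu(x)}{4\pi|x-y|^3}\psi(y)d\sigma(y)$. On the space of mean-zero elements of $H^{-1/2}(\partial B)$ with inner product $\langle\varphi_1,\varphi_2\rangle_*=-\langle\mathcal{S}_B[\varphi_2],\varphi_1\rangle_{\frac12,-\frac12}$, $\mathcal{K}_B^*$ is self-adjoint; $\lambda_n$ is one of its eigenvalues, with $|\lambda_n|<1/2$. $\langle\nu,\phi\rangle_*\in\mathbb{C}^3$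 is the vector with components $\langle\nu_i,\phi\rangle_*$. The particle is assumed symmetric in the sense that $\langle\nu,\phi_n\rangle_*\langle\nu,\phi_n\rangle_*^\top=c_nI$ for some $c_n>0$, where the left side denotes the sum of $\langle\nu,\phi\rangle_*\langle\nu,\phi\rangle_*^\top$ ($\top$ = Hermitian conjugate) over an orthonormal basis of the eigenspace of $\lambda_n$, and $I$ is the $3\times3$ identity. **Matrices.** $$\lambda_\epsilon=\frac{\epsilon_c+\epsilon_m(1+\gamma_m^2\beta_m^2)}{2(\epsilon_c-\epsilon_m(1+\gamma_m^2\beta_m^2))},\quad \lambda_\mu=\frac{\mu_m+\mu_m(1+\gamma_m^2\beta_m^2)}{2(\mu_m-\mu_m(1+\gamma_m^2\beta_m^2))},$$ $$d_\epsilon=\frac{\epsilon_m\mu_m\beta_m\tilde\gamma_m}{\epsilon_c-\epsilon_m(1+\gamma_m^2\beta_m^2)},\quad d_\mu=\frac{\epsilon_m\mu_m\beta_m\tilde\gamma_m}{\mu_m-\mu_m(1+\gamma_m^2\beta_m^2)},$$ $$A_n=\begin{pmatrix}\lambda_\epsilon-\lambda_n& i\omega d_\epsilon(\frac12+\lambda_n)\\ -i\omega d_\mu(\frac12+\lambda_n)&\lambda_\mu-\lambda_n\end{pmatrix},\qquad M_n(\epsilon_c,B)=-A_n^{-1}\begin{pmatrix}1&-i\omega d_\epsilon\\ i\omega d_\mu&1\end{pmatrix},$$ $$K_0=\begin{pmatrix}\frac{\epsilon_c}{\epsilon_m}-\tilde\gamma_m& -i\omega\mu_m\beta_m\tilde\gamma_m\\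 i\omega\epsilon_m\beta_m\tilde\gamma_m&1-\tilde\gamma_m\end{pmatrix}.$$ $\det A_n(\epsilon_c)$ vanishes exactly at the resonant permittivity $$\epsilon_{c,n}^*=-\epsilon_m\frac{\frac12+\lambda_n}{\frac12-\lambda_n}\Big(1-k_m^2\beta_m^2(\tfrac12-\lambda_n)\Big)^{-1}<0.$$ **Effective parameters.** Define $$\begin{pmatrix}\tilde\epsilon_{\mathrm{eff}}^N& i\omega\tilde{\tilde\mu}_{\mathrm{eff}}^N\\ -i\omega\tilde{\tilde\epsilon}_{\mathrm{eff}}^N&\tilde\mu_{\mathrm{eff}}^N\end{pmatrix}=\Lambda N^{-3a}c_nK_0M_n(\epsilon_c,B),\qquad \begin{pmatrix}\tilde\epsilon_{\mathrm{eff}}& i\omega\tilde{\tilde\mu}_{\mathrm{eff}}\\ -i\omega\tilde{\tilde\epsilon}_{\mathrm{eff}}&\tilde\mu_{\mathrm{eff}}\end{pmatrix}=\widetilde V\lim_{N\to\infty}\begin{pmatrix}\tilde\epsilon_{\mathrm{eff}}^N& i\omega\tilde{\tilde\mu}_{\mathrm{eff}}^N\\ -i\omega\tilde{\tilde\epsilon}_{\mathrm{eff}}^N&\tilde\mu_{\mathrm{eff}}^N\end{pmatrix}.$$ The effective permittivity $\epsilon_{\mathrm{eff}}$, permeability $\mu_{\mathrm{eff}}$ and chiral admittance $\beta_{\mathrm{eff}}$ are determined by $$\tilde\epsilon_{\mathrm{eff}}=\frac{\epsilon_{\mathrm{eff}}}{\epsilon_m(1-\omega^2\epsilon_{\mathrm{eff}}\mu_{\mathrm{eff}}\beta_{\mathrm{eff}}^2)}-\tilde\gamma_m,\quad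 \tilde\mu_{\mathrm{eff}}=\frac{\mu_{\mathrm{eff}}}{\mu_m(1-\omega^2\epsilon_{\mathrm{eff}}\mu_{\mathrm{eff}}\beta_{\mathrm{eff}}^2)}-\tilde\gamma_m,$$ $$\tilde{\tilde\epsilon}_{\mathrm{eff}}=\frac{\epsilon_{\mathrm{eff}}\mu_{\mathrm{eff}}\beta_{\mathrm{eff}}}{\mu_m(1-\omega^2\epsilon_{\mathrm{eff}}\mu_{\mathrm{eff}}\beta_{\mathrm{eff}}^2)}-\epsilon_m\beta_m\tilde\gamma_m,$$ which gives $$\epsilon_{\mathrm{eff}}=\epsilon_m\left((\tilde\epsilon_{\mathrm{eff}}+\tilde\gamma_m)-\omega^2(\tilde{\tilde\epsilon}_{\mathrm{eff}}+\epsilon_m\beta_m\tilde\gamma_m)\frac{\tilde{\tilde\mu}_{\mathrm{eff}}+\mu_m\beta_m\tilde\gamma_m}{\tilde\mu_{\mathrm{eff}}+\tilde\gamma_m}\right),$$ $$\mu_{\mathrm{eff}}=\mu_m\left((\tilde\mu_{\mathrm{eff}}+\tilde\gamma_m)-\omega^2(\tilde{\tilde\mu}_{\mathrm{eff}}+\mu_m\beta_m\tilde\gamma_m)\frac{\tilde{\tilde\epsilon}_{\mathrm{eff}}+\epsilon_m\beta_m\tilde\gamma_m}{\tilde\epsilon_{\mathrm{eff}}+\tilde\gamma_m}\right).$$ They are the coefficients, inside the domain, of the homogenized Drude-Born-Fedorov system. *)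

(* Defs.v *)
(* Mathematical Components / MathComp-Analysis, with [R[i]] from real-closed. *)
From HB Require Import structures.
From mathcomp Require Import all_boot all_order all_algebra.
From mathcomp Require Import all_classical all_reals all_analysis.
From mathcomp Require Import complex.

Set Implicit Arguments.
Unset Strict Implicit.
Unset Printing Implicit Defensive.

Import Order.TTheory GRing.Theory Num.Theory.
Import numFieldNormedType.Exports.

Local Open Scope classical_set_scope.
Local Open Scope complex_scope.
Local Open Scope ring_scope.

Section EuclideanSpace.
Variable R : realType.

(* R^3 is the triple product, which carries both the topology and the Borel
   sigma-algebra. The library's norm on it is the sup norm, hence [enorm]. *)
Definition coord (j : 'I_3) (x : R * R * R) : R :=
  nth 0 [:: x.1.1; x.1.2; x.2] j.

Definition dot (x y : R * R * R) : R :=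
  x.1.1 * y.1.1 + x.1.2 * y.1.2 + x.2 * y.2.

Definition enorm (x : R * R * R) : R := Num.sqrt (dot x x).

Definition cross (x y : R * R * R) : R * R * R :=
  (x.1.2 * y.2 - x.2 * y.1.2, x.2 * y.1.1 - x.1.1 * y.2,
   x.1.1 * y.1.2 - x.1.2 * y.1.1).

(* C^infinity on an open set U: all iterated directional derivatives exist and
   are continuous there. *)
Definition smooth_on (V : normedModType R) (U : set V) (f : V -> R) : Prop :=
  forall (s : seq V) (x : V), U x ->
    let g := foldr (fun v h => fun y => 'D_v h y) f s in
    {for x, continuous g} /\ forall v : V, derivable g x v.

Definition gradient (f : R * R * R -> R) (x : R * R * R) : R * R * R :=
  ('D_(1, 0, 0) f x, 'D_(0, 1, 0) f x, 'D_(0, 0, 1) f x).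

Definition bdry (B : set (R * R * R)) : set (R * R * R) :=
  closure B `\` interior B.

Definition local_defining_function (B : set (R * R * R)) (x : R * R * R)
    (U : set (R * R * R)) (f : R * R * R -> R) : Prop :=
  [/\ open U, U x, smooth_on U f,
      forall y, U y -> (B y <-> f y < 0)
    & forall y, U y -> gradient f y != 0].

Definition bounded_smooth_open (B : set (R * R * R)) : Prop :=
  [/\ open B, bounded_set B
    & forall x, bdry B x -> exists U f, local_defining_function B x U f].

Definition outward_normal (B : set (R * R * R)) (nu : R * R * R -> R * R * R)
    : Prop :=
  forall x, bdry B x -> forall U f, local_defining_function B x U f ->
    nu x = (enorm (gradient f x))^-1 *: gradient f x.

(* The surface measure of the surface G: carried by G, and given on the image
   of every regular parametrization X by the area element |X_1 x X_2| du. *)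
Definition surface_measure (G : set (R * R * R))
    (sigma : {measure set (R * R * R) -> \bar R}) : Prop :=
  sigma (~` G) = 0%E /\
  forall (U : set (R * R)) (X : R * R -> R * R * R),
    let N u := cross ('D_(1, 0) X u) ('D_(0, 1) X u) in
    open U -> (forall j, smooth_on U (coord j \o X)) ->
    set_inj U X -> X @` U `<=` G -> (forall u, U u -> N u != 0) ->
    forall A, measurable A -> A `<=` X @` U ->
      sigma A = (\int[lebesgue_measure \x lebesgue_measure]_(u in
                   U `&` X @^-1` A) (enorm (N u))%:E)%E.

End EuclideanSpace.

Section NeumannPoincare.
Variable R : realType.
Variables (G : set (R * R * R)) (sigma : {measure set (R * R * R) -> \bar R}).
Variable nu : R * R * R -> R * R * R.

Notation fct := (R * R * R -> R[i]).

Definition sqmod (z : R[i]) : R := complex.Re z ^+ 2 + complex.Im z ^+ 2.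

Definition cint (f : fct) : R[i] :=
  (\int[sigma]_(x in G) complex.Re (f x)) +i*
  (\int[sigma]_(x in G) complex.Im (f x)).

(* Squared H^{1/2}(G) norm (Sobolev-Slobodeckij; dim G = 2). *)
Definition sqnorm12 (u : fct) : \bar R :=
  (\int[sigma]_(x in G) (sqmod (u x))%:E +
   \int[sigma]_(x in G) \int[sigma]_(y in G)
     (sqmod (u x - u y) / enorm (x - y) ^+ 3)%:E)%E.

Definition H12 (u : fct) : Prop :=
  [/\ measurable_fun G (fun x => complex.Re (u x)),
      measurable_fun G (fun x => complex.Im (u x))
    & (sqnorm12 u < +oo)%E].

(* H^{-1/2}(G) is the dual of H^{1/2}(G): phi u is the bilinear pairing of u
   and phi, so that a density psi acts by u |-> \int_G u psi. Only the values
   of phi on H^{1/2}(G) matter; in particular phi = 0 means [Hm12_zero phi]. *)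
Definition Hm12 (phi : fct -> R[i]) : Prop :=
  (forall (a : R[i]) (u v : fct), H12 u -> H12 v ->
     phi (fun x => a * u x + v x) = a * phi u + phi v) /\
  exists M : R, forall u, H12 u -> ((sqmod (phi u))%:E <= M%:E * sqnorm12 u)%E.

Definition Hm12_zero (phi : fct -> R[i]) : Prop := forall u, H12 u -> phi u = 0.

Definition of_density (psi : fct) : fct -> R[i] :=
  fun u => cint (fun x => u x * psi x).

Definition mean_zero (phi : fct -> R[i]) : Prop := phi (fun=> 1) = 0.

Definition single_layer_density (psi : fct) : fct := fun x =>
  - ((4 * pi)^-1)%:C * cint (fun y => ((enorm (x - y))^-1)%:C * psi y).

Definition ccontinuous (psi : fct) : Prop :=
  continuous (fun x => complex.Re (psi x)) /\
  continuous (fun x => complex.Im (psi x)).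

(* S[phi] in H^{1/2}(G) for phi in H^{-1/2}(G), the extension of the above by
   symmetry of the kernel: \int_G S[phi] psi = < S[psi], phi >. *)
Definition is_single_layer (phi : fct -> R[i]) (u : fct) : Prop :=
  H12 u /\ forall psi, ccontinuous psi ->
    cint (fun x => u x * psi x) = phi (single_layer_density psi).

Definition single_layer (phi : fct -> R[i]) : fct :=
  xget (fun=> 0) [set u | is_single_layer phi u].

(* The duality <u, phi>_{1/2,-1/2} is taken antilinear in u, making the inner
   product Hermitian. *)
Definition star (phi1 phi2 : fct -> R[i]) : R[i] :=
  - phi1 (fun x => (single_layer phi2 x)^*).

(* K^* on H^{-1/2}(G), as the transpose of the operator K on H^{1/2}(G) whose
   kernel is that of K^* with x and y exchanged. *)
Definition double_layer (u : fct) : fct := fun x =>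
  cint (fun y => (dot (y - x) (nu y) / (4 * pi * enorm (x - y) ^+ 3))%:C * u y).

Definition Kstar (phi : fct -> R[i]) : fct -> R[i] :=
  fun u => phi (double_layer u).

Definition eigenspace_Kstar (lam : R) : set (fct -> R[i]) :=
  [set phi | [/\ Hm12 phi, mean_zero phi
    & forall u, H12 u -> Kstar phi u = lam%:C * phi u]].

Definition eigenvalue_Kstar (lam : R) : Prop :=
  exists phi, eigenspace_Kstar lam phi /\ ~ Hm12_zero phi.

(* The index set J may be finite or infinite (eigenvalue 0). *)
Definition orthonormal_basis (E : set (fct -> R[i])) (J : set nat)
    (phi : nat -> fct -> R[i]) : Prop :=
  [/\ forall j, J j -> E (phi j),
      forall j k, J j -> J k -> star (phi j) (phi k) = (j == k)%:R
    & forall psi, E psi -> (forall j, J j -> star psi (phi j) = 0) ->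
        Hm12_zero psi].

Definition nu_comp (a : 'I_3) : fct -> R[i] :=
  of_density (fun x => (coord a (nu x))%:C).

(* The sum of <nu,phi>_* <nu,phi>_*^H over an orthonormal basis of the
   eigenspace of lam is c I. *)
Definition symmetric_particle (lam c : R) : Prop :=
  exists J phi, orthonormal_basis (eigenspace_Kstar lam) J phi /\
    forall a b : 'I_3,
      (fun m : nat => \sum_(0 <= k < m | k \in J)
         star (nu_comp a) (phi k) * (star (nu_comp b) (phi k))^*
         : R[i]^o) @ \oo --> ((c * (a == b)%:R)%:C : R[i]^o).

End NeumannPoincare.

Section Particles.
Variable R : realType.

Definition particle_size (Lambda a : R) (N : nat) : R :=
  Lambda `^ (3%:R^-1) * N%:R `^ (- 1 - a).

(* z N j, j < N^3, are the centers. The particles lie in D (for N large, since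
   delta is not small for small N), and N^{-3} sum_j f(z N j) tends to
   \int_D f V. *)
Definition particle_configuration (D B : set (R * R * R)) (Lambda a : R)
    (z : nat -> nat -> R * R * R) (V : R * R * R -> R) : Prop :=
  [/\ forall N j, (j < N ^ 3)%N -> D (z N j),
      \forall N \near \oo, forall j, (j < N ^ 3)%N ->
        [set particle_size Lambda a N *: b + z N j | b in B] `<=` D,
      smooth_on D V
    & forall f : R * R * R -> R, continuous f ->
        (fun N : nat => (N%:R ^+ 3)^-1 * \sum_(0 <= j < N ^ 3) f (z N j))
          @ \oo --> \int[(lebesgue_measure \x lebesgue_measure \x
                          lebesgue_measure)%E]_(x in D) (f x * V x)].

End Particles.

Section EffectiveParameters.
Variable R : realType.
Variables (omega epsm mum betam : R).

Definition mx22 (a b c d : R[i]) : 'M[R[i]]_2 :=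
  \matrix_(i < 2, j < 2)
    if i == 0 then (if j == 0 then a else b) else (if j == 0 then c else d).

Definition wavenumber : R := omega * Num.sqrt (epsm * mum).

Definition tgamma : R := (1 - wavenumber ^+ 2 * betam ^+ 2)^-1.

Definition sqgamma : R :=
  wavenumber ^+ 2 / (1 - wavenumber ^+ 2 * betam ^+ 2).

Definition lambda_eps (epsc : R) : R :=
  (epsc + epsm * (1 + sqgamma * betam ^+ 2)) /
  (2 * (epsc - epsm * (1 + sqgamma * betam ^+ 2))).

Definition lambda_mu : R :=
  (mum + mum * (1 + sqgamma * betam ^+ 2)) /
  (2 * (mum - mum * (1 + sqgamma * betam ^+ 2))).

Definition d_eps (epsc : R) : R :=
  epsm * mum * betam * tgamma / (epsc - epsm * (1 + sqgamma * betam ^+ 2)).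

Definition d_mu : R :=
  epsm * mum * betam * tgamma / (mum - mum * (1 + sqgamma * betam ^+ 2)).

Definition A_mx (lam epsc : R) : 'M[R[i]]_2 :=
  mx22 (lambda_eps epsc - lam)%:C
       ('i * (omega * d_eps epsc * (2^-1 + lam))%:C)
       (- 'i * (omega * d_mu * (2^-1 + lam))%:C)
       (lambda_mu - lam)%:C.

Definition M_mx (lam epsc : R) : 'M[R[i]]_2 :=
  - (invmx (A_mx lam epsc) *m
     mx22 1 (- 'i * (omega * d_eps epsc)%:C) ('i * (omega * d_mu)%:C) 1).

Definition K0_mx (epsc : R) : 'M[R[i]]_2 :=
  mx22 (epsc / epsm - tgamma)%:C
       (- 'i * (omega * mum * betam * tgamma)%:C)
       ('i * (omega * epsm * betam * tgamma)%:C)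
       (1 - tgamma)%:C.

Definition eps_star (lam : R) : R :=
  - epsm * ((2^-1 + lam) / (2^-1 - lam)) *
  (1 - wavenumber ^+ 2 * betam ^+ 2 * (2^-1 - lam))^-1.

Definition effective_mx_N (Lambda a lam c : R) (epsc : nat -> R) (N : nat)
    : 'M[R[i]]_2 :=
  (Lambda * N%:R `^ (- (3 * a)) * c)%:C *:
  (K0_mx (epsc N) *m M_mx lam (epsc N)).

(* te, tm are the one-tilde parameters, tte, ttm the two-tilde ones;
   Vx is the density at the point considered. *)
Definition tilde_parameters (Lambda a lam c Vx : R) (epsc : nat -> R)
    (te tm tte ttm : R[i]) : Prop :=
  exists L : 'M[R[i]]_2,
    (forall i j, (fun N => effective_mx_N Lambda a lam c epsc N i j : R[i]^o)
       @ \oo --> (L i j : R[i]^o)) /\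
    mx22 te ('i * omega%:C * ttm) (- 'i * omega%:C * tte) tm = Vx%:C *: L.

(* eps, mu, beta are the effective permittivity, permeability and chiral
   admittance. They are complex a priori; [eps < 0] in R[i] says that eps is
   real and negative. *)
Definition effective_parameters (Lambda a lam c Vx : R) (epsc : nat -> R)
    (eps mu beta : R[i]) : Prop :=
  let Delta := 1 - omega%:C ^+ 2 * eps * mu * beta ^+ 2 in
  exists te tm tte ttm : R[i],
    [/\ tilde_parameters Lambda a lam c Vx epsc te tm tte ttm, Delta != 0,
        te = eps / (epsm%:C * Delta) - tgamma%:C,
        tm = mu / (mum%:C * Delta) - tgamma%:C
      & tte = eps * mu * beta / (mum%:C * Delta) -
              (epsm * betam * tgamma)%:C].

End EffectiveParameters.

(* Main.v *)
Require Import Defs.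
From HB Require Import structures.
From mathcomp Require Import all_boot all_order all_algebra.
From mathcomp Require Import all_classical all_reals all_analysis.
From mathcomp Require Import complex ring lra.

Set Implicit Arguments.
Unset Strict Implicit.
Unset Printing Implicit Defensive.

Import Order.TTheory GRing.Theory Num.Theory.
Import numFieldNormedType.Exports.

Local Open Scope classical_set_scope.
Local Open Scope ring_scope.

(** The sequence tau_N = Lambda N^{-3a} c tends to 0, and epsc approaches the
   resonant value at the rate tau_N / s.  Since det A_n has a simple zero
   there, tau_N A_n^{-1}, hence the effective matrix, keeps a finite nonzero
   limit, which is found explicitly; the sign question is then about two
   elementary expressions.

   Write p = k^2 beta^2 < 1, g = 1 / (1 - p), l = 1/2 - lam, h = 1/2 + lam,
   X = epsc - epsm g, Y = mum (1 - g), D = omega epsm mum beta g.  Clearing the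
   denominators X and Y from the rows of A_n leaves a Hermitian matrix T, and
   with Q = [[X, - i D], [i D, Y]] one finds
     K_0 M_n = - diag (1 / epsm, 1 / mum) Q T^{-1} Q,
     det T = mum l (l + g h) (epsc - eps_star).
   The choice of epsc makes kappa = tau_N / det T independent of N, so that
   tau_N K_0 M_n = - kappa diag (1 / epsm, 1 / mum) Q adj(T) Q is polynomial in
   epsc, and its limit is its value at eps_star ([scaled_K0_M_mxE],
   [cvg_effective_mx_N]).  There adj(T) has rank one and the product collapses
   ([response_at_resonanceE]) to
     eps~ = - s g,  mu~ = - s l^2 p g,
     eps~~ = - s l epsm beta g,  mu~~ = - s l mum beta g.

   Put a1 = eps~ + g = g (1 - s), a2 = mu~ + g = g (1 - s l^2 p) and
   a3 = eps~~ + epsm beta g = epsm beta g (1 - s l).  The system defining the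
   effective parameters forces
     eps = epsm a1 Delta,  mu = mum a2 Delta,
     Delta = 1 - omega^2 mum a3^2 / (epsm a1 a2)
           = 1 - p (1 - s l)^2 / ((1 - s) (1 - s l^2 p))
   ([effective_system_unique], [effective_system_exists]).  As a1 and a2 are
   positive, both parameters have the sign of Delta, and Delta tends to minus
   infinity as s tends to 1: the numerator stays above p (1 - l)^2 = p h^2 and
   the denominator is at most 1 - s, so s0 = 1 - p h^2 will do. *)

(** * Matrices with imaginary off-diagonal entries *)

Section TwistedMatrices.
Variable R : realType.
Implicit Types a b c d : R.

(** Conjugation by diag (1, - i) turns the real matrix [[a, b], [c, d]] into
   [[a, i b], [- i c, d]].  All the matrices of the problem are of this form, so
   their products and inverses are computed over the reals. *)
Definition twist_mx a b c d : 'M[R[i]]_2 :=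
  mx22 a%:C%C ('i * b%:C%C) (- 'i * c%:C%C) d%:C%C.

Lemma eq_mx22P (m n : 'M[R[i]]_2) :
  [/\ m 0 0 = n 0 0, m 0 1 = n 0 1, m 1 0 = n 1 0 & m 1 1 = n 1 1] <-> m = n.
Proof.
split=> [[e00 e01 e10 e11]|-> //]; apply/matrixP => i j.
have ord2 (k : 'I_2) : k = 0 \/ k = 1.
  by case: k => -[|[|//]] k2; [left|right]; exact: val_inj.
by case: (ord2 i) => ->; case: (ord2 j) => ->.
Qed.

Lemma mulCiN (x y : R[i]) : ('i * x) * (- 'i * y) = x * y.
Proof. by rewrite mulrACA mulrN -expr2 sqrCi opprK mul1r. Qed.

Lemma mul_twist_mx a b c d a' b' c' d' :
  twist_mx a b c d *m twist_mx a' b' c' d' =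
  twist_mx (a * a' + b * c') (a * b' + b * d')
           (c * a' + d * c') (c * b' + d * d').
Proof.
apply/eq_mx22P; split; rewrite !mxE big_ord_recl big_ord1 !mxE /=;
  rewrite !(rmorphD, rmorphM) /= ?mulCiN; try by ring.
by rewrite [X in X + _]mulrC mulCiN; ring.
Qed.

Lemma opp_twist_mx a b c d :
  - twist_mx a b c d = twist_mx (- a) (- b) (- c) (- d).
Proof. by apply/eq_mx22P; split; rewrite !mxE /= !rmorphN //= mulrN. Qed.

Lemma scale_twist_mx t a b c d :
  t%:C%C *: twist_mx a b c d = twist_mx (t * a) (t * b) (t * c) (t * d).
Proof. by apply/eq_mx22P; split; rewrite !mxE /= !rmorphM //= mulrCA. Qed.

Lemma twist_mxN a b c d :
  mx22 a%:C%C (- 'i * b%:C%C) ('i * c%:C%C) d%:C%C = twist_mx a (- b) (- c) d.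
Proof. by rewrite /twist_mx !rmorphN /= mulrNN mulrN mulNr. Qed.

Lemma twist_mx1 : twist_mx 1 0 0 1 = 1%:M.
Proof. by apply/eq_mx22P; split; rewrite !mxE /= ?rmorph0 ?mulr0. Qed.

(** The determinant is a parameter [D] so that it can be supplied in the form
   that suits the subsequent simplification. *)
Lemma inv_twist_mx a b c d (D : R) : D = a * d - b * c -> D != 0 ->
  invmx (twist_mx a b c d) = twist_mx (d / D) (- b / D) (- c / D) (a / D).
Proof.
move=> defD D0; set m := twist_mx a b c d; set m' := twist_mx (d / D) _ _ _.
have mm' : m *m m' = 1%:M.
  rewrite mul_twist_mx -twist_mx1.
  by congr twist_mx; rewrite defD; field; rewrite -defD.
have [um _] := mulmx1_unit mm'.
by rewrite -[m']mul1mx -(mulVmx um) -mulmxA mm' mulmx1.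
Qed.

End TwistedMatrices.

(** * Limits *)

Section Limits.
Variable R : realType.

Lemma cvg_natr_powRN (r : R) : 0 < r -> (N%:R : R) `^ (- r) @[N --> \oo] --> (0 : R).
Proof.
(* Shifted by one, N^{-r} is (1 / N)^r with 1 / N tending to 0 from the right. *)
move=> r0; rewrite -cvg_shiftS /=.
have : (fun N => (harmonic N : R) `^ r) @ \oo --> (0 : R).
  apply: (cvg_at_rightP (fun x : R => x `^ r) 0 0).1; first exact: powR_cvg0.
  by split; [exact: harmonic_gt0|exact: cvg_harmonic].
apply: cvg_trans; apply: near_eq_cvg; near=> N => /=.
by rewrite -[- r]mulN1r powRrM powR_inv1 ?ler0n.
Unshelve. all: by end_near. Qed.

(** In [R[i]] a positive radius is a positive real, and the embedding of the
   reals is isometric. *)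
Lemma cvg_real_complex (u : nat -> R) (x : R) : u @ \oo --> x ->
  (fun N => (u N)%:C%C : R[i]^o) @ \oo --> (x%:C%C : R[i]^o).
Proof.
move=> ux; apply/cvgrPdist_lt => -[e e'] /=; rewrite ltcE /= => /andP[/eqP -> e0].
move/cvgrPdist_lt : ux => /(_ _ e0); apply: filterS => N.
by rewrite -rmorphB normc_def /= expr0n addr0 sqrtr_sqr ltcR.
Qed.

Lemma cvg_twist_mx (b00 b01 b10 b11 : nat -> R) (x00 x01 x10 x11 : R) :
  b00 @ \oo --> x00 -> b01 @ \oo --> x01 ->
  b10 @ \oo --> x10 -> b11 @ \oo --> x11 ->
  forall i j,
    (fun N => twist_mx (b00 N) (b01 N) (b10 N) (b11 N) i j : R[i]^o) @ \oo -->
    (twist_mx x00 x01 x10 x11 i j : R[i]^o).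
Proof.
move=> c00 c01 c10 c11 [[|[|//]] i2] [[|[|//]] j2]; rewrite mxE /=;
  under eq_fun do rewrite mxE /=.
- exact: cvg_real_complex.
- by apply: cvgMl_tmp; exact: cvg_real_complex.
- by apply: cvgMl_tmp; exact: cvg_real_complex.
- exact: cvg_real_complex.
Qed.

End Limits.

(** * Solving for the effective parameters *)

Section DrudeBornFedorov.
Variable F : fieldType.
Variables (w2 em mm a1 a2 a3 : F).
Hypotheses (em0 : em != 0) (mm0 : mm != 0) (a10 : a1 != 0) (a20 : a2 != 0).
Let Delta0 := 1 - w2 * mm * a3 ^+ 2 / (em * a1 * a2).

(** Substituting the three equations into [Delta0] gives back [Delta]: with
   eps and mu proportional to Delta and beta = a3 / (em a1 a2 Delta), the term
   eps mu beta^2 does not depend on Delta.  So Delta is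
   determined by a1, a2 and a3. *)
Lemma effective_system_unique eps mu beta (Delta := 1 - w2 * eps * mu * beta ^+ 2) :
  Delta != 0 -> a1 = eps / (em * Delta) -> a2 = mu / (mm * Delta) ->
  a3 = eps * mu * beta / (mm * Delta) ->
  eps = em * a1 * Delta0 /\ mu = mm * a2 * Delta0.
Proof.
move=> D0 e1 e2 e3.
have eps0 : eps != 0 by apply: contraNneq a10 => e; rewrite e1 e mul0r.
have mu0 : mu != 0 by apply: contraNneq a20 => e; rewrite e2 e mul0r.
have -> : Delta0 = Delta.
  have DE : Delta = 1 - w2 * eps * mu * beta ^+ 2 by [].
  rewrite /Delta0 e1 e2 e3 [RHS]DE; field.
  by rewrite mu0 mm0 eps0 em0 D0.
by rewrite e1 e2; split; field; rewrite ?em0 ?mm0 D0.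
Qed.

Lemma effective_system_exists : Delta0 != 0 ->
  exists eps mu beta : F, let Delta := 1 - w2 * eps * mu * beta ^+ 2 in
  [/\ Delta != 0, a1 = eps / (em * Delta), a2 = mu / (mm * Delta) &
      a3 = eps * mu * beta / (mm * Delta)].
Proof.
move=> D0; exists (em * a1 * Delta0), (mm * a2 * Delta0), (a3 / (em * a1 * a2 * Delta0)).
move=> Delta.
have -> : Delta = Delta0.
  have DE : Delta0 = 1 - w2 * mm * a3 ^+ 2 / (em * a1 * a2) by [].
  by rewrite /Delta [RHS]DE; field; rewrite D0 a20 a10 em0.
by split=> //; field; rewrite ?D0 ?a10 ?a20 ?em0 ?mm0.
Qed.

End DrudeBornFedorov.

(** * The rescaled response near resonance *)

Section Response.
Variables (R : realType) (omega epsm mum betam lam : R).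
Hypotheses (epsm_gt0 : 0 < epsm) (mum_gt0 : 0 < mum).
Hypotheses (omega_gt0 : 0 < omega) (betam_gt0 : 0 < betam).

(* p is k^2 beta^2, and g is both tgamma and 1 + gamma^2 beta^2. *)
Let p := (omega * betam) ^+ 2 * (epsm * mum).
Hypothesis p_lt1 : p < 1.
Let g := (1 - p)^-1.
Let l := 2^-1 - lam.
Let h := 2^-1 + lam.
Let D := omega * epsm * mum * betam * g.
Let Y := mum * (1 - g).
Hypotheses (l_gt0 : 0 < l) (h_gt0 : 0 < h).

Let p_gt0 : 0 < p. Proof. by rewrite !(exprn_gt0, mulr_gt0). Qed.

Lemma wavenumber_beta2 : wavenumber omega epsm mum ^+ 2 * betam ^+ 2 = p.
Proof.
by rewrite /wavenumber exprMn sqr_sqrtr ?mulr_ge0 ?ltW // /p; ring.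
Qed.

Lemma tgammaE : tgamma omega epsm mum betam = g.
Proof. by rewrite /tgamma wavenumber_beta2. Qed.

Let p1_gt0 : 0 < 1 - p. Proof. by rewrite subr_gt0. Qed.
Let pneq : 1 - p != 0. Proof. by rewrite subr_eq0 eq_sym lt_eqF. Qed.

Lemma sqgammaE : 1 + sqgamma omega epsm mum betam * betam ^+ 2 = g.
Proof.
by rewrite /sqgamma wavenumber_beta2 mulrAC wavenumber_beta2 /g; field.
Qed.

(* The cleared matrix T is [[t11, i D h], [- i D h, t22]]: it is A with its rows
   multiplied by X and Y.  Only t11 depends on the permittivity, and it is
   affine in X. *)
Let t22 := mum * (l + g * h).
Let t11 X := epsm * g + l * X.

Let g_gt1 : 1 < g.
Proof. by rewrite /g invf_gt1 ?subr_gt0 // ltrBlDr ltrDl p_gt0. Qed.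

Let mum_neq0 : mum != 0. Proof. by rewrite gt_eqF. Qed.
Let epsm_neq0 : epsm != 0. Proof. by rewrite gt_eqF. Qed.
Let g_neq0 : g != 0. Proof. by rewrite gt_eqF // invr_gt0 subr_gt0. Qed.
Let g_gt0 : 0 < g. Proof. exact: lt_trans g_gt1. Qed.
Let g_neq1 : 1 - g != 0. Proof. by rewrite subr_eq0 lt_eqF. Qed.
Let Y_neq0 : Y != 0. Proof. exact: mulf_neq0. Qed.
Let Y_neq0' : mum - mum * g != 0.
Proof. by rewrite -[X in X - _]mulr1 -mulrBr. Qed.

Lemma A_mxE epsc (X := epsc - epsm * g) : X != 0 ->
  A_mx omega epsm mum betam lam epsc =
  twist_mx (t11 X / X) (D * h / X) (D * h / Y) (t22 / Y).
Proof.
move=> X0; have X0' : epsc - epsm * g != 0 by [].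
rewrite /A_mx /twist_mx /lambda_eps /lambda_mu /d_eps /d_mu sqgammaE tgammaE.
congr (mx22 (_)%:C%C (_ * (_)%:C%C) (_ * (_)%:C%C) (_)%:C%C);
  rewrite /t11 /t22 /X /Y /l /h /D; field; rewrite ?g_neq1 ?mum_neq0 ?Y_neq0' ?X0' //.
Qed.

(** The matrix on the left is the right factor of M; multiplying its rows by X
   and Y turns it into Q, which is also K0 with its rows multiplied by epsm and
   mum. *)
Lemma chirality_mxE epsc (X := epsc - epsm * g) : X != 0 ->
  mx22 1 (- 'i * (omega * d_eps omega epsm mum betam epsc)%:C%C)
    ('i * (omega * d_mu omega epsm mum betam)%:C%C) 1 =
  twist_mx 1 (- D / X) (- D / Y) 1.
Proof.
move=> X0; have X0' : epsc - epsm * g != 0 by [].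
rewrite (twist_mxN 1) /d_eps /d_mu sqgammaE tgammaE.
by congr twist_mx; rewrite /X /Y /D; field; rewrite ?g_neq1 ?mum_neq0 ?Y_neq0' ?X0' //.
Qed.

Lemma K0_mxE epsc (X := epsc - epsm * g) :
  K0_mx omega epsm mum betam epsc =
  twist_mx (X / epsm) (- D / epsm) (- D / mum) (Y / mum).
Proof.
rewrite /K0_mx tgammaE twist_mxN.
by congr twist_mx; rewrite /X /Y /D; field; rewrite ?mum_neq0 ?epsm_neq0.
Qed.

Let hE : h = 1 - l. Proof. by rewrite /h /l; field. Qed.
Let pE : p = (g - 1) / g. Proof. by rewrite /g; field; rewrite pneq. Qed.
Let DD : D ^+ 2 = g * (g - 1) * (epsm * mum).
Proof.
rewrite -[g - 1](divfK g_neq0) -pE /D /p; ring.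
Qed.

Let l_neq0 : l != 0. Proof. by rewrite gt_eqF. Qed.
Let q_gt0 : 0 < l + g * h.
Proof. by rewrite addr_gt0 ?mulr_gt0. Qed.
Let q_neq0 : l + g * h != 0. Proof. by rewrite gt_eqF. Qed.

(** Expressing p through g and h through l makes the factor 1 - p l of the
   resonant permittivity comparable with the entry t22 = mum (l + g h). *)
Lemma one_sub_plE : 1 - p * l = (l + g * h) / g.
Proof. by rewrite pE hE; field. Qed.

Lemma eps_starE :
  eps_star omega epsm mum betam lam = - (epsm * g * h) / (l * (l + g * h)).
Proof.
rewrite /eps_star wavenumber_beta2 -/l -/h one_sub_plE; field.
by rewrite l_neq0 g_neq0 q_neq0.
Qed.

(** The determinant is affine in the permittivity, because only t11 depends on
   it: its zero at resonance is simple. *)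
Lemma det_clearedE epsc (X := epsc - epsm * g) :
  t11 X * t22 - (D * h) ^+ 2 =
  l * t22 * (epsc - eps_star omega epsm mum betam lam).
Proof.
rewrite exprMn DD eps_starE /t11 /t22 /X.
move: q_neq0; rewrite hE => q0; field.
by rewrite l_neq0 q0.
Qed.

Lemma M_mxE epsc (X := epsc - epsm * g) (dT := t11 X * t22 - (D * h) ^+ 2) :
  X != 0 -> dT != 0 ->
  M_mx omega epsm mum betam lam epsc =
  twist_mx (- (t22 * X + D ^+ 2 * h) / dT) (D * (t22 + Y * h) / dT)
    (D * (h * X + t11 X) / dT) (- (D ^+ 2 * h + t11 X * Y) / dT).
Proof.
move=> X0 dT0; rewrite /M_mx chirality_mxE // A_mxE // -/X.
rewrite (@inv_twist_mx _ _ _ _ _ (dT / (X * Y))); last 2 first.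
- by rewrite /dT; field; rewrite X0 Y_neq0.
- by rewrite mulf_neq0 // invr_eq0 mulf_neq0.
rewrite mul_twist_mx opp_twist_mx; congr twist_mx; field; rewrite X0 Y_neq0 dT0 //.
Qed.

(* - kappa diag (1 / epsm, 1 / mum) Q adj(T) Q is the twist of these four. *)
Let r00 kappa X : R :=
  - kappa / epsm * (X * (t22 * X + D ^+ 2 * h) + D ^+ 2 * (h * X + t11 X)).
Let r01 kappa X : R :=
  kappa / epsm * (D * (X * (t22 + Y * h) + (D ^+ 2 * h + t11 X * Y))).
Let r10 kappa X : R :=
  kappa / mum * (D * ((t22 * X + D ^+ 2 * h) + Y * (h * X + t11 X))).
Let r11 kappa X : R :=
  - kappa / mum * (D ^+ 2 * (t22 + Y * h) + Y * (D ^+ 2 * h + t11 X * Y)).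

(** Once tau is proportional to det T the pole of T^{-1} disappears, and the
   entries are polynomials in the permittivity. *)
Lemma scaled_K0_M_mxE epsc tau kappa (X := epsc - epsm * g)
    (dT := t11 X * t22 - (D * h) ^+ 2) :
  X != 0 -> dT != 0 -> tau = kappa * dT ->
  tau%:C%C *: (K0_mx omega epsm mum betam epsc *m
               M_mx omega epsm mum betam lam epsc) =
  twist_mx (r00 kappa X) (r01 kappa X) (r10 kappa X) (r11 kappa X).
Proof.
move=> X0 dT0 ->; rewrite K0_mxE M_mxE // mul_twist_mx scale_twist_mx -/X -/dT.
by congr twist_mx; rewrite /r00 /r01 /r10 /r11; field; rewrite dT0 ?epsm_neq0 ?mum_neq0.
Qed.

(** At resonance adj(T) = u u^* / t22 with u = (t22, i D h), and
   Q u = mum (- epsm g / l, i D); the twist of the values below is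
   - kappa diag (1 / epsm, 1 / mum) (Q u) (Q u)^* / t22. *)
Lemma response_at_resonanceE s (X := eps_star omega epsm mum betam lam - epsm * g)
  (kappa := s * l ^+ 2 * (l + g * h) / (epsm * mum * g)) :
  [/\ r00 kappa X = - (s * g), r01 kappa X = - (s * l * (D / epsm)),
      r10 kappa X = - (s * l * (D / mum)) &
      r11 kappa X = - (s * l ^+ 2 * (p * g))].
Proof.
rewrite /r00 /r01 /r10 /r11 /kappa /t22 /t11 /Y /X DD eps_starE pE.
move: q_neq0; rewrite hE => q0.
split; field; rewrite ?l_neq0 ?g_neq0 ?q0 ?epsm_neq0 ?mum_neq0 //.
Qed.

(** The rate at which epsc approaches the resonance makes the ratio [kappa] of
   tau to det T the same for all N > 0; the limit is then the value at resonance
   of polynomial entries. *)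
Lemma cvg_effective_mx_N (Lambda a c s : R) (epsc : nat -> R) :
  0 < Lambda -> 0 < a -> 0 < c -> 0 < s ->
  (forall N : nat, (0 < N)%N ->
     epsc N = eps_star omega epsm mum betam lam +
       s^-1 * (Lambda * N%:R `^ (- (3 * a)) * c * epsm /
         ((2^-1 - lam) ^+ 3 *
          (1 - betam ^+ 2 * wavenumber omega epsm mum ^+ 2 *
                 (2^-1 - lam)) ^+ 2)) *
       (tgamma omega epsm mum betam)^-1) ->
  forall i j,
    (fun N => effective_mx_N omega epsm mum betam Lambda a lam c epsc N i j
       : R[i]^o) @ \oo -->
    (twist_mx (- (s * g)) (- (s * l * (D / epsm))) (- (s * l * (D / mum)))
       (- (s * l ^+ 2 * (p * g))) i j : R[i]^o).
Proof.
move=> Lambda0 a0 c0 s0 epscE i j.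
pose tau (N : nat) := Lambda * N%:R `^ (- (3 * a)) * c.
have tau0 : tau @ \oo --> 0.
  rewrite -(mul0r c) -[X in X * c](mulr0 Lambda); apply: cvgMr_tmp.
  apply: cvgMl_tmp.
  by apply: cvg_natr_powRN; rewrite mulr_gt0.
have tau_gt0 N : (0 < N)%N -> 0 < tau N.
  by move=> N0; rewrite !mulr_gt0 // powR_gt0 // ltr0n.
(* eta is the distance of epsc to the resonance, a constant multiple of tau. *)
pose eta N := s^-1 * (epsm / (l ^+ 3 * ((l + g * h) / g) ^+ 2)) / g * tau N.
have epscE' N : (0 < N)%N ->
    epsc N = eps_star omega epsm mum betam lam + eta N.
  move=> N0; rewrite epscE // -/l [betam ^+ 2 * _]mulrC wavenumber_beta2.
  by rewrite tgammaE one_sub_plE -/(tau N) /eta; congr (_ + _); ring.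
pose X0 := eps_star omega epsm mum betam lam - epsm * g.
pose X N := eps_star omega epsm mum betam lam + eta N - epsm * g.
have cX : X @ \oo --> eps_star omega epsm mum betam lam - epsm * g.
  apply: cvgB; last exact: cvg_cst.
  rewrite -[X in _ --> X]addr0; apply: cvgD; first exact: cvg_cst.
  pose r := s^-1 * (epsm / (l ^+ 3 * ((l + g * h) / g) ^+ 2)) / g.
  by rewrite -[X in _ --> X](mulr0 r); apply: cvgMl_tmp.
(* At resonance X < 0, hence X N != 0 for large N, as the inversion of A needs. *)
have X_lt0 : eps_star omega epsm mum betam lam - epsm * g < 0.
  rewrite eps_starE mulNr -opprD oppr_lt0.
  by rewrite addr_gt0 ?divr_gt0 ?mulr_gt0.
have [e00 e01 e10 e11] := response_at_resonanceE s.
have cT : (fun N => t11 (X N)) @ \oo -->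
    t11 (eps_star omega epsm mum betam lam - epsm * g).
  by apply: cvgD; [exact: cvg_cst|exact: cvgMl_tmp].
rewrite -e00 -e01 -e10 -e11.
pose kappa := s * l ^+ 2 * (l + g * h) / (epsm * mum * g).
have c00 : (fun N => r00 kappa (X N)) @ \oo --> r00 kappa X0.
  by repeat first [exact: cX|exact: cT|exact: cvg_cst|apply: cvgD|apply: cvgM].
have c01 : (fun N => r01 kappa (X N)) @ \oo --> r01 kappa X0.
  by repeat first [exact: cX|exact: cT|exact: cvg_cst|apply: cvgD|apply: cvgM].
have c10 : (fun N => r10 kappa (X N)) @ \oo --> r10 kappa X0.
  by repeat first [exact: cX|exact: cT|exact: cvg_cst|apply: cvgD|apply: cvgM].
have c11 : (fun N => r11 kappa (X N)) @ \oo --> r11 kappa X0.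
  by repeat first [exact: cX|exact: cT|exact: cvg_cst|apply: cvgD|apply: cvgM].
have := @cvg_twist_mx _ _ _ _ _ _ _ _ _ c00 c01 c10 c11 i j.
apply: cvg_trans; apply: near_eq_cvg; near=> N => /=.
have N0 : (0 < N)%N by near: N; exact: nbhs_infty_gt.
have XN : X N < 0 by near: N; exact: (cvgr_lt _ cX).
have XE : epsc N - epsm * g = X N by rewrite epscE'.
have dTE : t11 (X N) * t22 - (D * h) ^+ 2 = l * t22 * eta N.
  by rewrite -XE det_clearedE epscE' // [X in _ * X = _]addrC addKr.
have eta0 : eta N != 0.
  by rewrite gt_eqF // /eta mulr_gt0 ?tau_gt0 // divr_gt0 // mulr_gt0 ?invr_gt0 //
    divr_gt0 // mulr_gt0 ?exprn_gt0 // divr_gt0.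
rewrite /effective_mx_N -/(tau N).
rewrite (@scaled_K0_M_mxE _ _ kappa) XE // ?dTE.
- by rewrite lt_eqF.
- by rewrite mulf_neq0 // mulf_neq0 // /t22 mulf_neq0.
- rewrite /kappa /eta /t22; field.
  by rewrite (gt_eqF s0) epsm_neq0 mum_neq0 g_neq0 l_neq0 q_neq0.
Unshelve. all: by end_near. Qed.

End Response.

(** * The tilde parameters *)

Section LimitingParameters.
Variables (R : realType) (omega epsm mum betam Lambda a lam c : R).
Variables (epsc : nat -> R) (te tm tte ttm : R[i]).

(** Uniqueness of limits identifies the matrix in [tilde_parameters]; dividing
   by omega and i isolates the two-tilde parameters. *)
Lemma tilde_parametersP (b00 b01 b10 b11 : R) : omega != 0 ->
  (forall i j, (fun N => effective_mx_N omega epsm mum betam Lambda a lam c epsc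
     N i j : R[i]^o) @ \oo --> (twist_mx b00 b01 b10 b11 i j : R[i]^o)) ->
  tilde_parameters omega epsm mum betam Lambda a lam c 1 epsc te tm tte ttm <->
  [/\ te = b00%:C%C, tm = b11%:C%C, tte = (b10 / omega)%:C%C &
      ttm = (b01 / omega)%:C%C].
Proof.
move=> w0 cvgL.
have wC0 : omega%:C%C != 0 :> R[i] by rewrite fmorph_eq0.
have i0 : 'i != 0 :> R[i] by exact: neq0Ci.
have tildeE : tilde_parameters omega epsm mum betam Lambda a lam c 1 epsc te tm
    tte ttm <-> mx22 te ('i * omega%:C%C * ttm) (- 'i * omega%:C%C * tte) tm =
                twist_mx b00 b01 b10 b11.
  split=> [[L' [cvgL' ->]]|e]; last first.
    by exists (twist_mx b00 b01 b10 b11); rewrite e rmorph1 scale1r.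
  rewrite rmorph1 scale1r; apply/matrixP => i j.
  exact: (norm_cvg_unique (cvgL' i j) (cvgL i j)).
apply: iff_trans tildeE _; rewrite -eq_mx22P !mxE /=.
split=> [[-> e01 e10 ->]|[-> -> -> ->]]; split=> //.
- apply: (mulfI wC0); apply: (mulfI i0); rewrite -rmorphM /=.
  by apply: oppr_inj; rewrite -!mulNr mulrA e10 [b10 / _]mulrC mulVKf.
- apply: (mulfI wC0); apply: (mulfI i0); rewrite -rmorphM /=.
  by rewrite mulrA e01 [b01 / _]mulrC mulVKf.
- by rewrite -mulrA -rmorphM /= [b01 / _]mulrC mulVKf.
- by rewrite -mulrA -rmorphM /= [b10 / _]mulrC mulVKf.
Qed.

End LimitingParameters.

(** * Negativity of the effective parameters *)

Theorem theorem2 (R : realType)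
  (omega epsm mum betam : R)
  (omega_gt0 : 0 < omega) (epsm_gt0 : 0 < epsm)
  (mum_gt0 : 0 < mum) (betam_gt0 : 0 < betam)
  (kbeta_lt1 : wavenumber omega epsm mum * betam < 1)
  (Lambda a : R) (Lambda_gt0 : 0 < Lambda) (a_gt0 : 0 < a)
  (B : set (R * R * R)) (nu : R * R * R -> R * R * R)
  (sigma : {measure set (R * R * R) -> \bar R})
  (B_smooth : bounded_smooth_open B)
  (nu_normal : outward_normal B nu)
  (sigma_surface : surface_measure (bdry B) sigma)
  (lam c : R)
  (lam_eigen : eigenvalue_Kstar (bdry B) sigma nu lam)
  (lam_lt : `|lam| < 2^-1)
  (c_gt0 : 0 < c)
  (B_symmetric : symmetric_particle (bdry B) sigma nu lam c)
  (D : set (R * R * R)) (z : nat -> nat -> R * R * R) (V : R * R * R -> R)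
  (D_smooth : bounded_smooth_open D) (D_connected : connected D)
  (z_config : particle_configuration D B Lambda a z V)
  (x : R * R * R) (x_D : D x) (V_x : V x = 1) :
  exists s0 : R, 0 < s0 < 1 /\
    forall s : R, s0 < s < 1 ->
    forall epsc : nat -> R,
      (forall N : nat, (0 < N)%N ->
         epsc N = eps_star omega epsm mum betam lam +
           s^-1 * (Lambda * N%:R `^ (- (3 * a)) * c * epsm /
             ((2^-1 - lam) ^+ 3 *
              (1 - betam ^+ 2 * wavenumber omega epsm mum ^+ 2 *
                     (2^-1 - lam)) ^+ 2)) *
           (tgamma omega epsm mum betam)^-1) ->
      (exists eps mu beta : R[i],
         effective_parameters omega epsm mum betam Lambda a lam c (V x) epsc
           eps mu beta) /\
      (forall eps mu beta : R[i],
         effective_parameters omega epsm mum betam Lambda a lam c (V x) epsc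
           eps mu beta -> eps < 0 /\ mu < 0).
Proof.
set p := (omega * betam) ^+ 2 * (epsm * mum).
set l := 2^-1 - lam; set h := 2^-1 + lam.
have k0 : 0 <= wavenumber omega epsm mum * betam.
  by rewrite !mulr_ge0 ?sqrtr_ge0 // ltW.
have pE : p = (wavenumber omega epsm mum * betam) ^+ 2.
  by rewrite exprMn wavenumber_beta2.
have p_lt1 : p < 1 by rewrite pE expr_lt1.
have p_gt0 : 0 < p by rewrite !(mulr_gt0, exprn_gt0).
have [l_gt0 h_gt0] : 0 < l /\ 0 < h.
  by move: lam_lt; rewrite ltr_norml /l /h => /andP[]; split; lra.
have hl : h = 1 - l by rewrite /l /h; field.
have l_lt1 : l < 1 by lra.
have h_lt1 : h < 1 by lra.
have ph_gt0 : 0 < p * h ^+ 2 by rewrite mulr_gt0 ?exprn_gt0.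
have ph_lt1 : p * h ^+ 2 < 1.
  by rewrite -[ltRHS]mulr1 ltr_pM ?sqr_ge0 ?expr_lt1 // ltW.
exists (1 - p * h ^+ 2); split; first by apply/andP; split; lra.
move=> s /andP[s_gt s_lt1] epsc epscE.
have s_gt0 : 0 < s by lra.
pose g := (1 - p)^-1.
have g_gt0 : 0 < g by rewrite invr_gt0 subr_gt0.
have cvgL := cvg_effective_mx_N epsm_gt0 mum_gt0 omega_gt0 betam_gt0 p_lt1 l_gt0
  h_gt0 Lambda_gt0 a_gt0 c_gt0 s_gt0 epscE.
rewrite -/p -/l -/g in cvgL.
have sl_lt1 : s * l < 1 by nra.
have slp_lt1 : s * l ^+ 2 * p < 1.
  have l2 : l ^+ 2 * p < 1 by rewrite -[ltRHS]mulr1 ltr_pM ?expr_lt1 ?sqr_ge0 ?ltW.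
  by rewrite -mulrA -[ltRHS]mulr1 ltr_pM ?ltW // mulr_gt0 ?exprn_gt0.
pose a1 := g * (1 - s).
pose a2 := g * (1 - s * l ^+ 2 * p).
pose a3 := epsm * betam * g * (1 - s * l).
have s1_gt0 : 0 < 1 - s by rewrite subr_gt0.
have slp1_gt0 : 0 < 1 - s * l ^+ 2 * p by rewrite subr_gt0.
have a1_gt0 : 0 < a1 by rewrite mulr_gt0.
have a2_gt0 : 0 < a2 by rewrite mulr_gt0.
pose Delta0 := 1 - omega ^+ 2 * mum * a3 ^+ 2 / (epsm * a1 * a2).
(* (1 - s) (1 - s l^2 p) <= 1 - s < p h^2 <= p (1 - s l)^2, the last step
   because h = 1 - l <= 1 - s l. *)
have Delta0_lt0 : Delta0 < 0.
  rewrite subr_lt0 ltr_pdivlMr ?mul1r ?mulr_gt0 //.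
  have -> : omega ^+ 2 * mum * a3 ^+ 2 = epsm * g ^+ 2 * (p * (1 - s * l) ^+ 2).
    by rewrite /a3 /p; ring.
  have -> : epsm * a1 * a2 = epsm * g ^+ 2 * ((1 - s) * (1 - s * l ^+ 2 * p)).
    by rewrite /a1 /a2; ring.
  rewrite ltr_pM2l ?mulr_gt0 ?exprn_gt0 //.
  apply: (@le_lt_trans _ _ (1 - s)).
    by rewrite ger_pMr ?subr_gt0 // gerBl !mulr_ge0 ?sqr_ge0 // ltW.
  apply: (@lt_le_trans _ _ (p * h ^+ 2)); first by lra.
  by rewrite ler_pM2l // ler_sqr ?nnegrE; nra.
have tilde te tm tte ttm : tilde_parameters omega epsm mum betam Lambda a lam c
    (V x) epsc te tm tte ttm <->
  [/\ te = (a1 - g)%:C%C, tm = (a2 - g)%:C%C,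
      tte = (a3 - epsm * betam * g)%:C%C &
      ttm = (- (s * l * mum * betam * g))%:C%C].
  rewrite V_x; apply: iff_trans (tilde_parametersP _ _ _ _ _ cvgL) _.
    by rewrite gt_eqF.
  by split=> -[-> -> -> ->]; split; congr (_%:C%C);
    rewrite /a1 /a2 /a3; field; rewrite ?gt_eqF.
have gE : tgamma omega epsm mum betam = g by rewrite tgammaE.
have Delta0C : 1 - omega%:C%C ^+ 2 * mum%:C%C * a3%:C%C ^+ 2 /
    (epsm%:C%C * a1%:C%C * a2%:C%C) = Delta0%:C%C.
  by rewrite /Delta0 rmorphB rmorph1 !(rmorphM, rmorphXn, fmorphV).
have neqC (u : R) : 0 < u -> u%:C%C != 0 :> R[i].
  by move=> u0; rewrite fmorph_eq0 gt_eqF.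
split.
  have [|eps [mu [beta [D0 e1 e2 e3]]]] := @effective_system_exists _ (omega%:C%C ^+ 2)
      epsm%:C%C mum%:C%C a1%:C%C a2%:C%C a3%:C%C (neqC _ epsm_gt0)
      (neqC _ mum_gt0) (neqC _ a1_gt0) (neqC _ a2_gt0).
    by rewrite Delta0C fmorph_eq0 lt_eqF.
  exists eps, mu, beta, (a1 - g)%:C%C, (a2 - g)%:C%C,
    (a3 - epsm * betam * g)%:C%C, (- (s * l * mum * betam * g))%:C%C.
  split; [exact/tilde|exact: D0| | |];
    by rewrite rmorphB gE -?e1 -?e2 -?e3.
move=> eps mu beta [te [tm [tte [ttm [/tilde [-> -> -> _] D0]]]]].
rewrite gE !rmorphB => /addIr e1 /addIr e2 /addIr e3.
have [-> ->] := effective_system_unique (neqC _ epsm_gt0) (neqC _ mum_gt0)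
  (neqC _ a1_gt0) (neqC _ a2_gt0) D0 e1 e2 e3.
by rewrite Delta0C -!rmorphM /= !ltcR; split; rewrite nmulr_llt0 ?mulr_gt0.
Qed.
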